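(* For every $n\ge 2$ and every finite relational signature $\tau$ containing an $n$-ary relation symbol, there exists a class of finite structures of signature $\tau$ that is not decided by an adaptive left $k$-query algorithm over $\mathbb{N}$ for any $k$.
   Context: Structures are finite relational structures with non-empty domain; $\mathsf{FIN}(\tau)$ is the class of all such structures of signature $\tau$; classes are closed under isomorphism. $\hom(F,A)$ is the number of homomorphisms $F\to A$. For a set $\Sigma$, $\Sigma^{<\omega}$ is the set of finite strings over $\Sigma$; a subtree is a prefix-closed subset, a leaf an element with no proper extension in it. An adaptive left query algorithm over $\mathbb{N}$ is a function $G:\mathcal{T}\to\mathsf{FIN}(\tau)\cup\{\mathsf{YES},\mathsf{NO}\}$ with $\mathcal{T}\subseteq\mathbb{N}^{<\omega}$ a subtree and $G(\sigma)\in\{\mathsf{YES},\mathsf{NO}\}$ iff $\sigma$ is a leaf. Its computation path on input $A$ is the limit of $\sigma_0=\varepsilon$, $\sigma_{i+1}=\sigma_i$ if $G(\sigma_i)\in\{\mathsf{YES},\mathsf{NO}\}$, else $\sigma_{i+1}=\sigma_i\bullet\hom(G(\sigma_i),A)$. The algorithm must halt (finite path) on all inputs; it decides $\{A:G(\text{path of }A)=\mathsf{YES}\}$. It is an adaptive left $k$-query algorithm if every computation path has length at most $k$. *)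

(* Defs.v *)
From HB Require Import structures.
From mathcomp Require Import all_boot.

Set Implicit Arguments.
Unset Strict Implicit.
Unset Printing Implicit Defensive.

Record signature := Signature {
  symbol :> finType;
  arity : symbol -> nat
}.

Record structure (tau : signature) := Structure {
  dom :> finType;
  dom_gt0 : 0 < #|dom|;
  interp : forall R : tau, {set (arity R).-tuple dom}
}.

Section Structures.
Variable tau : signature.
Implicit Types A B F : structure tau.

Definition is_hom F A (f : F -> A) : bool :=
  [forall R : tau, [forall t in interp F R, map_tuple f t \in interp A R]].

Definition hom F A : nat := #|[set f : {ffun F -> A} | is_hom f]|.

Definition isomorphic A B : Prop :=
  exists2 f : A -> B, bijective f &
    forall (R : tau) (t : (arity R).-tuple A),
      (map_tuple f t \in interp B R) = (t \in interp A R).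

Definition iso_closed (C : structure tau -> Prop) : Prop :=
  forall A B, isomorphic A B -> C A -> C B.

End Structures.

Definition prefix_closed (T : seq nat -> Prop) : Prop :=
  forall s t, prefix s t -> T t -> T s.

Definition leaf (T : seq nat -> Prop) (s : seq nat) : Prop :=
  T s /\ forall t, T t -> prefix s t -> t = s.

Inductive node (tau : signature) := Query of structure tau | Yes | No.
Arguments Yes {tau}.
Arguments No {tau}.

Definition is_answer (tau : signature) (x : node tau) : bool :=
  if x is Query _ then false else true.

(* The function G with domain the subtree [tree] is represented by a function *)
(* [label] on all strings; its values outside [tree] carry no meaning.        *)
Record left_algorithm (tau : signature) := LeftAlgorithm {
  tree : seq nat -> Prop;
  label : seq nat -> node tau;
  tree_prefix_closed : prefix_closed tree;
  answer_iff_leaf : forall s, tree s -> (is_answer (label s) <-> leaf tree s)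
}.

Section Computation.
Variables (tau : signature) (G : left_algorithm tau).
Implicit Type A : structure tau.

Definition next A (s : seq nat) : seq nat :=
  if label G s is Query F then rcons s (hom F A) else s.

(* The i-th approximation of the computation path, starting from the empty    *)
(* string.                                                                    *)
Definition approx A (i : nat) : seq nat := iter i (next A) [::].

(* [s] is the finite computation path on A. Requiring [tree G s] rules out    *)
(* computations that leave the domain of G: by prefix-closure, it puts all    *)
(* the approximations in the tree. In particular the tree is non-empty.       *)
Definition computation_path A (s : seq nat) : Prop :=
  tree G s /\ exists N, forall i, N <= i -> approx A i = s.

Definition halting : Prop := forall A, exists s, computation_path A s.

(* The length of a path is the number of queries made along it.               *)
Definition is_left_query_algorithm (k : nat) : Prop :=
  halting /\ forall A s, computation_path A s -> size s <= k.

Definition decides (C : structure tau -> Prop) : Prop :=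
  forall A, C A <-> exists2 s, computation_path A s & label G s = Yes.

End Computation.

(* Main.v *)
(** Fix L and consider Z/2^(L+1) with the shifts by d = 2^i, 0 <= i <= L (as
    digraphs: disjoint unions of directed cycles of length 2^(L+1-i)).
    Homomorphisms from F into the shift by d are the solutions of a linear
    system over Z/2^(L+1) with right-hand side d, so their number is either 0
    or the number N_F of solutions of the homogeneous system, and multiplying a
    solution by 2^(j-i) shows that solvability is monotone in i.  Hence a query
    only tells on which side of some threshold i lies, and k adaptive queries
    cannot determine the parity of i once L >= 2^k. *)
From HB Require Import structures.
From mathcomp Require Import all_boot.
From mathcomp Require Import ssralg finalg zmodp.
From mathcomp Require Import zify.
Require Import Defs.

Set Implicit Arguments.
Unset Strict Implicit.
Unset Printing Implicit Defensive.

Import GRing.Theory.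

Lemma isomorphic_refl (tau : signature) (A : structure tau) : isomorphic A A.
Proof.
exists id => [|R t]; first by exists id.
by have -> : map_tuple id t = t by apply: val_inj; rewrite /= map_id.
Qed.

Lemma isomorphic_trans (tau : signature) (A B C : structure tau) :
  isomorphic A B -> isomorphic B C -> isomorphic A C.
Proof.
move=> [f bij_f fP] [g bij_g gP]; exists (g \o f); first exact: bij_comp bij_g bij_f.
move=> R t; rewrite -fP -gP.
by have -> : map_tuple (g \o f) t = map_tuple g (map_tuple f t)
  by apply: val_inj; rewrite /= map_comp.
Qed.

Section Shift.
Variables (tau : signature) (V : finZmodType).
Implicit Types (d : V) (F : structure tau).

(* Coordinates beyond the arity read as 0, so that the condition is linear in
   the tuple for symbols of every arity. *)
Definition shift_interp d (R : tau) : {set (arity R).-tuple V} :=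
  [set t : (arity R).-tuple V | (nth 0 t 1 - nth 0 t 0 == d)%R].

Lemma card_zmod_gt0 : 0 < #|V|.
Proof. by apply/card_gt0P; exists 0%R. Qed.

Definition shift d : structure tau := Structure card_zmod_gt0 (shift_interp d).

Lemma shift_homP d F (f : F -> V) :
  reflect (forall (R : tau) (t : (arity R).-tuple F), t \in interp F R ->
             nth 0%R (map f t) 1 - nth 0%R (map f t) 0 = d)%R
          (is_hom (A := shift d) f).
Proof.
apply: (iffP forallP) => [homf R t tR | homf R].
  by have /forall_inP/(_ t tR) := homf R; rewrite inE => /eqP.
by apply/forall_inP => t tR; rewrite inE; apply/eqP/homf.
Qed.

Lemma nth_mapD (T : Type) (f g h : T -> V) (s : seq T) i :
  (forall x, h x = f x + g x)%R ->
  (nth 0 (map h s) i = nth 0 (map f s) i + nth 0 (map g s) i)%R.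
Proof.
by move=> hE; elim: s i => [|x s IHs] [|i] //=; rewrite ?addr0 ?hE.
Qed.

Lemma shift_homD d e F (f g h : F -> V) :
  (forall x, h x = f x + g x)%R ->
  is_hom (A := shift d) f -> is_hom (A := shift e) g ->
  is_hom (A := shift (d + e)%R) h.
Proof.
move=> hE /shift_homP homf /shift_homP homg; apply/shift_homP => R t tR.
by rewrite !(nth_mapD _ _ hE) -(homf R t tR) -(homg R t tR) opprD addrACA.
Qed.

Lemma hom_shift_gt0 d F :
  (0 < hom F (shift d)) = [exists f : {ffun F -> V}, is_hom (A := shift d) f].
Proof.
by apply/card_gt0P/existsP => [] [f]; [rewrite inE|]; exists f; rewrite ?inE.
Qed.

Lemma shift_hom0 F : is_hom (A := shift 0%R) ([ffun=> 0%R] : {ffun F -> V}).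
Proof.
apply/shift_homP => R t _.
have nth0 i : nth 0%R (map [ffun=> 0%R : V] t) i = 0%R.
  by elim: (val t) i => [|x s IHs] [|i] //=; rewrite ffunE.
by rewrite !nth0 subrr.
Qed.

Lemma hom_shift_mulrn d m F :
  0 < hom F (shift d) -> 0 < hom F (shift (d *+ m)%R).
Proof.
rewrite !hom_shift_gt0 => /existsP[f homf]; elim: m => [|m /existsP[g homg]].
  by apply/existsP; exists [ffun=> 0%R]; apply: shift_hom0.
apply/existsP; exists [ffun x => f x + g x]%R; rewrite mulrS.
by apply: shift_homD homf homg => x; rewrite ffunE.
Qed.

(** Translation by a fixed solution [f] maps the solutions for [0] bijectively onto those for [d];
    the way back adds [- f], a solution for [- d]. *)
Lemma hom_shift_eq d F :
  0 < hom F (shift d) -> hom F (shift d) = hom F (shift 0%R).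
Proof.
rewrite hom_shift_gt0 => /existsP[f homf].
have homNf : is_hom (A := shift (- d)%R) ([ffun x => - f x]%R : {ffun F -> V}).
  apply/shift_homP => R t tR; have /shift_homP/(_ R t tR) <- := homf.
  have nthN i : nth 0%R (map [ffun x => - f x]%R t) i = (- nth 0 (map f t) i)%R.
    by elim: (val t) i => [|x s IHs] [|i] //=; rewrite ?oppr0 ?ffunE.
  by rewrite !nthN opprD.
rewrite /hom -[RHS](card_imset (mem [set g : {ffun F -> V} |
  is_hom (A := shift 0%R) g]) (addrI f)).
apply: eq_card => g; apply/idP/imsetP => [|[h]]; rewrite !inE.
  move=> homg; exists (g - f)%R; last by rewrite addrC subrK.
  rewrite inE -(subrr d); apply: shift_homD homg homNf => x.
  by rewrite !ffunE.
move=> homh ->; rewrite -(addr0 d).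
by apply: shift_homD homf homh => x; rewrite ffunE.
Qed.

End Shift.

(** An isomorphism conjugates translation by [d] to translation by [e], so [d] and [e] have the same
    additive order. *)
Lemma isomorphic_shift_mulrn (tau : signature) (V W : finZmodType)
    (d : V) (e : W) (R : tau) m :
  1 < arity R -> isomorphic (shift tau d) (shift tau e) ->
  (d *+ m == 0)%R = (e *+ m == 0)%R.
Proof.
move=> R_gt1 [f /bij_inj inj_f fP].
have fD x : f (x + d)%R = (f x + e)%R.
  (* Entries from index 2 on are filler; arity above 1 ensures that entry 1 is a genuine one and not
     the default [0]. *)
  pose t := [tuple (if i == 0 :> nat then x else x + d)%R | i < arity R].
  have R_gt0 := ltnW R_gt1.
  have nth_t i (Ri : i < arity R) :
      nth 0%R t i = (if i == 0 then x else x + d)%R.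
    by rewrite -[i]/(val (Ordinal Ri)) -tnth_nth tnth_mktuple.
  have := fP R t; rewrite !inE !(nth_map 0%R) ?size_tuple // !nth_t //=.
  by rewrite addrAC subrr add0r eqxx => /eqP <-; rewrite addrCA subrr addr0.
(* [f] need not fix [0], hence the offset [f 0]. *)
suff fm : f (d *+ m)%R = (f 0 + e *+ m)%R.
  by rewrite -(inj_eq inj_f) fm -subr_eq0 (addrC (f _)) addrK.
elim: m => [|m IHm]; first by rewrite !mulr0n addr0.
by rewrite !mulrSr fD IHm addrA.
Qed.

Section Paths.
Variables (tau : signature) (G : left_algorithm tau).
Implicit Type A : structure tau.

Lemma approxS A i : approx G A i.+1 = next G A (approx G A i).
Proof. by []. Qed.

Lemma size_approx A i :
  size (approx G A i) = i \/ next G A (approx G A i) = approx G A i.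
Proof.
elim: i => [|i [sz_i|fix_i]]; first by left.
  rewrite approxS; case E: (label G (approx G A i)) => [F||].
  - by left; rewrite /next E size_rcons sz_i.
  - by right; rewrite /next E E.
  - by right; rewrite /next E E.
by right; rewrite approxS !fix_i.
Qed.

Lemma approx_fixed A i j :
  next G A (approx G A i) = approx G A i -> i <= j ->
  approx G A j = approx G A i.
Proof.
move=> fix_i /subnK <-; elim: (j - i) => // m IHm.
by rewrite addSn approxS IHm.
Qed.

Lemma size_approx_homo A i j : i <= j -> size (approx G A i) <= size (approx G A j).
Proof.
move/subnK <-; elim: (j - i) => // m IHm; rewrite addSn approxS.
apply: leq_trans IHm _; rewrite /next.
by case: (label G _) => [F||] //; rewrite size_rcons.
Qed.

(** Until it stabilises, the computation lengthens its string by one at each step, so a limit of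
    length at most [k] is reached within [k] steps. *)
Lemma computation_path_approx A s k :
  computation_path G A s -> size s <= k -> approx G A k = s.
Proof.
move=> [_ [N sE]] sk.
have [sz_k|fix_k] := size_approx A k.+1.
  have := size_approx_homo A (leq_maxr N k.+1).
  by rewrite sz_k sE ?leq_maxl // ltnNge sk.
have [sz_k|fix_k'] := size_approx A k; last first.
  by rewrite -(sE (maxn N k)) ?leq_maxl // (approx_fixed fix_k') ?leq_maxr.
have sE' : approx G A k.+1 = s.
  by rewrite -(sE (maxn N k.+1)) ?leq_maxl // (approx_fixed fix_k) ?leq_maxr.
move: sE'; rewrite approxS {1}/next; case: (label G _) => // F sE'.
by move: sk; rewrite -sE' size_rcons sz_k ltnn.
Qed.

Lemma next_eq A B s :
  (forall F, label G s = Query F -> hom F A = hom F B) ->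
  next G A s = next G B s.
Proof. by rewrite /next; case: (label G s) => // F ->. Qed.

(* Bisection: of the interval on which the first computation steps agree, keep
   the half on which the next answer is constant. *)
Lemma indistinguishable_neighbours (B : nat -> structure tau) k :
  (forall F, exists c, forall i, hom F (B i) = 0 \/ hom F (B i) = c) ->
  (forall F i j, i <= j -> 0 < hom F (B i) -> 0 < hom F (B j)) ->
  exists2 a, a < 2 ^ k & approx G (B a) k = approx G (B a.+1) k.
Proof.
move=> two_values mono.
(* Both ends of the interval are included, so at [m = k] two neighbours remain. *)
suff H m : m <= k -> exists2 a, a + 2 ^ (k - m) <= 2 ^ k &
    exists s, forall i, a <= i <= a + 2 ^ (k - m) -> approx G (B i) m = s.
  have [a] := H k (leqnn k); rewrite subnn addn1 => lt_a [s sE].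
  by exists a; rewrite // !sE ?leqnn ?leqnSn.
elim: m => [_|m IHm lt_mk]; first by exists 0; [rewrite subn0 | exists [::]].
have [a le_a [s sE]] := IHm (ltnW lt_mk).
have kmE : 2 ^ (k - m) = 2 ^ (k - m.+1) + 2 ^ (k - m.+1).
  by rewrite addnn -mul2n -expnS subnSK.
set r := 2 ^ (k - m.+1) in kmE *; rewrite {}kmE in le_a sE.
have keep b : a <= b <= a + r ->
    (forall i F, b <= i <= b + r -> label G s = Query F ->
       hom F (B i) = hom F (B b)) ->
    exists2 a, a + r <= 2 ^ k &
      exists s, forall i, a <= i <= a + r -> approx G (B i) m.+1 = s.
  move=> b_ab const; exists b; first lia.
  exists (next G (B b) s) => i i_b; rewrite approxS sE; last lia.
  by apply: next_eq => F sF; apply: const.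
case E: (label G s) => [F||]; try by apply: (keep a) => [|i F _]; [lia | rewrite E].
(* The halves share the midpoint [a + r]: a zero count there spreads to the left half, a positive
   one to the right half. *)
have [mid0|mid_gt0] := posnP (hom F (B (a + r))).
  apply: (keep a) => [|i F' i_a]; first lia.
  rewrite E => -[<-]; have zero j : j <= a + r -> hom F (B j) = 0.
    move=> le_j; apply/eqP; rewrite -leqn0 leqNgt; apply/negP => j_gt0.
    by have := mono F _ _ le_j j_gt0; rewrite mid0.
  by rewrite !zero //; lia.
apply: (keep (a + r)) => [|i F' i_a]; first lia.
rewrite E => -[<-]; have [c cP] := two_values F.
have nonzero j : a + r <= j -> hom F (B j) = c.
  by move=> le_j; case: (cP j) (mono F _ _ le_j mid_gt0) => ->.
by rewrite !nonzero //; lia.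
Qed.

End Paths.

(** The exponent [L.+1] keeps the modulus at least 2, where ['Z_] is the ring of integers modulo its
    argument. For [i > L] the shift is by [0]. *)
Definition shift2 (tau : signature) (L i : nat) : structure tau :=
  shift tau ((2 ^ i)%:R : 'Z_(2 ^ L.+1))%R.

(** The cardinality determines the modulus; then the additive order [2 ^ (L.+1 - i)] of the shift
    determines [i]. *)
Lemma isomorphic_shift2 (tau : signature) (R : tau) L M i j :
  1 < arity R -> i <= L -> j <= M ->
  isomorphic (shift2 tau L i) (shift2 tau M j) -> i = j.
Proof.
move=> R_gt1 iL jM iso; have pow_gt1 K : 1 < 2 ^ K.+1 by rewrite -{1}(expn0 2) ltn_exp2l.
have LM : L = M.
  have [f /bij_eq_card] := iso.
  by rewrite !card_ord !Zp_cast // => /(expnI (leqnn 2)) [].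
subst M.
have natZ m : ((m%:R : 'Z_(2 ^ L.+1)) == 0)%R = (2 ^ L.+1 %| m).
  by rewrite -val_eqE /= val_Zp_nat.
have dvdE m : (2 ^ L.+1 %| 2 ^ (i + m)) = (2 ^ L.+1 %| 2 ^ (j + m)).
  by have := isomorphic_shift_mulrn (2 ^ m) R_gt1 iso; rewrite -!mulrnA -!expnD !natZ.
(* The exponent [L.+1 - i] gives [i <= j], and [L.+1 - j] the converse. *)
have := dvdE (L.+1 - i); have := dvdE (L.+1 - j); rewrite !dvdn_Pexp2l //; lia.
Qed.

Theorem theorem16 (n : nat) (hn : 2 <= n) (tau : signature)
    (htau : exists R : tau, arity R = n) :
  exists C : structure tau -> Prop,
    iso_closed C /\
    forall (k : nat) (G : left_algorithm tau),
      is_left_query_algorithm G k -> ~ decides G C.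
Proof.
have [R arR] := htau; have R_gt1 : 1 < arity R by rewrite arR.
(* All [L] are gathered in one class, since it must be chosen before [k]. *)
exists (fun A => exists L i, [/\ i <= L, ~~ odd i & isomorphic (shift2 tau L i) A]).
split=> [A B isoAB [L [i [iL ev_i isoA]]]|k G [halts short] dec].
  by exists L, i; split=> //; apply: isomorphic_trans isoAB.
pose L := 2 ^ k.
have two_values F : exists c, forall i,
    hom F (shift2 tau L i) = 0 \/ hom F (shift2 tau L i) = c.
  exists (hom F (shift tau (0%R : 'Z_(2 ^ L.+1)))) => i.
  by have [|/hom_shift_eq] := posnP (hom F (shift2 tau L i)); [left | right].
have mono F i j : i <= j -> 0 < hom F (shift2 tau L i) -> 0 < hom F (shift2 tau L j).
  move=> /subnKC ij /(hom_shift_mulrn (2 ^ (j - i))).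
  by rewrite -mulrnA -expnD ij.
have [a lt_aL eq_a] := indistinguishable_neighbours G k two_values mono.
have pathP i s : computation_path G (shift2 tau L i) s ->
    approx G (shift2 tau L i) k = s.
  by move=> path_s; apply: computation_path_approx (short _ _ path_s).
have [s path_s] := halts (shift2 tau L a).
have [t path_t] := halts (shift2 tau L a.+1).
have st : s = t by rewrite -(pathP _ _ path_s) eq_a (pathP _ _ path_t).
subst t.
(* The label of the common path [s] would settle the parity of both [a] and [a.+1].
   [isomorphic_shift2] rules out membership in the class through other indices. *)
have label_iff i : computation_path G (shift2 tau L i) s -> i <= L ->
    label G s = Yes <-> ~~ odd i.
  move=> path_i iL; split=> [sY | ev_i].
    have /dec[M [j [jM ev_j iso]]] : exists2 t,
        computation_path G (shift2 tau L i) t & label G t = Yes by exists s.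
    by rewrite (isomorphic_shift2 R_gt1 jM iL iso) in ev_j.
  have /dec[t path_ti <-] : exists M j, [/\ j <= M, ~~ odd j &
      isomorphic (shift2 tau M j) (shift2 tau L i)].
    by exists L, i; split=> //; apply: isomorphic_refl.
  by rewrite -(pathP _ _ path_i) -(pathP _ _ path_ti).
have := label_iff _ path_s (ltnW lt_aL); have := label_iff _ path_t lt_aL.
by rewrite /=; case: (odd a) => /= -> [H1 H2]; [move: (H1 isT) | move: (H2 isT)].
Qed.
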